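(* Let $\tilde w(t,x,\omega)$ be a random traveling wave solution of $u_t=u_{xx}+f(x,u,\omega)$ with front position $\tilde X(t,\omega)$ such that $\tilde w(t,\tilde X(t,\omega),\omega)=\theta_0$ for all $t\in\mathbb{R}$, $\lim_{t\to\infty}\tilde X(t,\omega)/t=c^*_+$ almost surely, and $\tilde X(\cdot,\omega)$ is increasing with inverse $\tilde T(x,\omega):\mathbb{R}\times\Omega\to\mathbb{R}$ defined by $x=\tilde X(\tilde T(x,\omega),\omega)$. Then the function $$\tilde w(\tilde T(\xi,\omega),\,x+\xi,\,\omega)$$ is stationary with respect to shifts in $\xi$; that is, the law of the random process $\xi\mapsto\tilde w(\tilde T(\xi,\omega),\cdot+\xi,\omega)$ (with values in functions of $x$) is invariant under translations of $\xi$.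
   Context: Standing assumptions. $\theta_0\in(0,1)$ and $f_0:\mathbb{R}\to\mathbb{R}$ is an ignition-type nonlinearity: $f_0$ is Lipschitz, $f_0(u)=0$ for $u\notin(\theta_0,1)$, $f_0(u)>0$ for $u\in(\theta_0,1)$, and $f_0'(1)<0$ (derivative from the left). Let $0<g^{min}\le g^{max}<\infty$ be constants and $(\Omega,\mathcal{F},\mathbb{P})$ a probability space with $\Omega=C(\mathbb{R};[g^{min},g^{max}])$ and $\mathcal{F}$ containing the Borel $\sigma$-algebra of the topology of locally uniform convergence. $\{\pi_x\}_{x\in\mathbb{R}}$ is a group of measure-preserving transformations acting ergodically on $(\Omega,\mathcal{F},\mathbb{P})$, and $g(x,\omega)$ is a stationary ergodic random field: $g(x+h,\omega)=g(x,\pi_h\omega)$. Almost surely, $g(\cdot,\omega)$ is Lipschitz continuous and $g^{min}\le g(x,\omega)\le g^{max}$ for all $x$. The reaction term is $f(x,u,\omega)=g(x,\omega)f_0(u)$. Definition (random traveling wave). A solution $\tilde w(t,x,\omega):\mathbb{R}\times\mathbb{R}\times\Omega\to\mathbb{R}$ of $u_t=u_{xx}+f(x,u,\omega)$ is a random traveling wave if: (i) for almost every $\omega$, $\tilde w(t,x,\omega)$ is a classical solution for all $t\in\mathbb{R}$; (ii) $\tilde w(0,x,\omega)$ is measurable with respect to $\omega$; (iii) $0<\tilde w(0,x,\omega)<1$ for all $x\in\mathbb{R}$; (iv) $\lim_{x\to+\infty}\tilde w(0,x,\omega)=0$ and $\lim_{x\to-\infty}\tilde w(0,x,\omega)=1$;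 (v) there exists a measurable function $\tilde X(t,\omega):\mathbb{R}\times\Omega\to\mathbb{R}$ (the front position) such that $\tilde w(t,x,\omega)=\tilde w(0,x-\tilde X(t,\omega),\pi_{\tilde X(t,\omega)}\omega)$. Constant $c^*_+$: there exist (unique) deterministic constants $c^*_-<0<c^*_+$ such that for each $h\in(\theta_0,1)$, if $L$ is sufficiently large, every solution $w$ of the equation with deterministic compactly supported initial data $0\le w_0\le1$, $w_0\ge h$ on an interval of length $L$, satisfies almost surely, for every (small) $\epsilon>0$, $\lim_{t\to\infty}\inf_{c\in[c^*_-+\epsilon,c^*_+-\epsilon]}w(t,ct,\omega)=1$ and $\lim_{t\to\infty}\sup_{c\in(-\infty,c^*_--\epsilon]\cup[c^*_++\epsilon,\infty)}w(t,ct,\omega)=0$. *)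

(* Defs.v *)
From HB Require Import structures.
From mathcomp Require Import all_boot all_order all_algebra.
From mathcomp Require Import all_classical all_reals all_analysis.
Import Order.TTheory GRing.Theory Num.Theory.
Import numFieldNormedType.Exports.

Set Implicit Arguments.
Unset Strict Implicit.
Unset Printing Implicit Defensive.

Local Open Scope classical_set_scope.
Local Open Scope ring_scope.

(* The sample space C(R; [gmin, gmax]). As a subset of
   {family compact, R -> R} it carries the topology of locally uniform
   convergence; the proof of gmin <= gmax makes it inhabited, as the library
   requires of a measurable space. *)
Definition cont_between (R : realType) (gmin gmax : R) :
    set {family compact, R -> R} :=
  [set w : R -> R | continuous w /\ forall x, gmin <= w x <= gmax].

Definition environment (R : realType) (gmin gmax : R) (hg : gmin <= gmax) :
    Type :=
  set_type (cont_between gmin gmax).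

Section environment_instances.
Context (R : realType) (gmin gmax : R) (hg : gmin <= gmax).

Lemma cont_between_cst :
  ((fun=> gmin) : {family compact, R -> R}) \in cont_between gmin gmax.
Proof.
by rewrite inE; split=> [|x]; [exact: cst_continuous | rewrite lexx hg].
Qed.

HB.instance Definition _ := Topological.copy (environment hg)
  (set_type (cont_between gmin gmax)).
HB.instance Definition _ := isPointed.Build (environment hg)
  (exist (fun w => w \in cont_between gmin gmax) _ cont_between_cst).

End environment_instances.

Definition ignition (R : realType) (theta0 : R) (f0 : R -> R) : Prop :=
  [/\ lipschitz f0,
      forall u, ~~ (theta0 < u < 1) -> f0 u = 0,
      forall u, theta0 < u < 1 -> 0 < f0 u
    & exists2 l : R, l < 0 & (f0 u - f0 1) / (u - 1) @[u --> 1^'-] --> l].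

Section random_media.
Context (R : realType) (d : measure_display) (Omega : measurableType d).
Context (P : probability Omega R).
Implicit Types (tau : R -> Omega -> Omega) (g : R -> Omega -> R).

Definition measure_preserving_group tau : Prop :=
  [/\ tau 0 = id,
      forall x y, tau (x + y) = tau x \o tau y,
      forall x, measurable_fun setT (tau x)
    & forall x (A : set Omega), measurable A -> P (tau x @^-1` A) = P A].

Definition acts_ergodically tau : Prop :=
  forall A : set Omega, measurable A -> (forall x, tau x @^-1` A = A) ->
    P A = 0%E \/ P A = 1%E.

Definition stationary_field tau g : Prop :=
  (forall x, measurable_fun setT (g x)) /\
  (forall x h omega, g (x + h) omega = g x (tau h omega)).

(* C^{1,2} solutions of u_t = u_xx + F(x, u) for t in the open set I. *)
Definition classical_solution (F : R -> R -> R) (I : set R)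
    (u : R -> R -> R) : Prop :=
  forall t x, I t ->
    [/\ derivable (u ^~ x) t 1,
        derivable (u t) x 1 /\ derivable (derive1 (u t)) x 1,
        [/\ {for (t, x), continuous (fun p : R * R => u p.1 p.2)},
            {for (t, x), continuous (fun p : R * R => derive1 (u ^~ p.2) p.1)},
            {for (t, x), continuous (fun p : R * R => derive1 (u p.1) p.2)}
          & {for (t, x), continuous (fun p : R * R => derive1n 2 (u p.1) p.2)}]
      & derive1 (u ^~ x) t = derive1n 2 (u t) x + F x (u t x)].

(* Bounded classical solutions on t > 0; boundedness excludes the non-unique
   solutions of Tychonoff type. The datum u0 need not be continuous, so it is
   attained in L^1_loc. *)
Definition cauchy_solution (F : R -> R -> R) (u0 : R -> R)
    (u : R -> R -> R) : Prop :=
  [/\ classical_solution F [set t | 0 < t] u,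
      exists M, forall t x, 0 < t -> `|u t x| <= M
    & forall a b : R,
        (\int[lebesgue_measure]_(x in `[a, b]) `|u t x - u0 x|%:E)%E
          @[t --> 0^'+] --> 0%E].

Definition reaction g (f0 : R -> R) (omega : Omega) : R -> R -> R :=
  fun x u => g x omega * f0 u.

(* The upper bound on eps keeps the interval of the infimum nonempty
   (the library sets inf set0 = 0). *)
Definition spreads (cm cp : R) (u : R -> R -> R) : Prop :=
  forall eps : R, 0 < eps -> cm + eps <= cp - eps ->
    (inf [set u t (c * t) | c in `[cm + eps, cp - eps]%classic]
       @[t --> +oo] --> (1 : R)) /\
    (sup [set u t (c * t) |
            c in `]-oo, cm - eps]%classic `|` `[cp + eps, +oo[%classic]
       @[t --> +oo] --> (0 : R)).

Definition spreading_speeds (theta0 : R) (f0 : R -> R) g (cm cp : R) : Prop :=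
  [/\ cm < 0, 0 < cp
    & forall h : R, theta0 < h < 1 ->
      \forall L \near +oo,
      forall w0 : R -> R,
        measurable_fun setT w0 ->
        compact (closure [set x | w0 x != 0]) ->
        (forall x, 0 <= w0 x <= 1) ->
        (exists a, forall x, a <= x <= a + L -> h <= w0 x) ->
      forall w : R -> R -> Omega -> R,
        {ae P, forall omega,
          cauchy_solution (reaction g f0 omega) w0
            (fun t x => w t x omega)} ->
        {ae P, forall omega, spreads cm cp (fun t x => w t x omega)}].

Definition front_position tau (w : R -> R -> Omega -> R)
    (X : R -> Omega -> R) : Prop :=
  measurable_fun setT (fun p : R * Omega => X p.1 p.2) /\
  (forall t x omega,
     w t x omega = w 0 (x - X t omega) (tau (X t omega) omega)).

Definition random_traveling_wave tau g (f0 : R -> R)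
    (w : R -> R -> Omega -> R) : Prop :=
  [/\ {ae P, forall omega,
        classical_solution (reaction g f0 omega) setT
          (fun t x => w t x omega)},
      forall x, measurable_fun setT (w 0 x),
      forall x omega, 0 < w 0 x omega < 1,
      forall omega, (w 0 x omega @[x --> +oo] --> (0 : R)) /\
                    (w 0 x omega @[x --> -oo] --> (1 : R))
    & exists X, front_position tau w X].

End random_media.

(* Functions I -> E with the product sigma-algebra, generated by the
   evaluations. For E = R its trace on continuous functions is the Borel
   sigma-algebra of locally uniform convergence. *)
Definition cylinders (I : Type) (d : measure_display) (E : measurableType d) :
    set (set (I -> E)) :=
  [set A | exists i (B : set E), measurable B /\ A = [set y | B (y i)]].

Definition function_space (I : Type) (d : measure_display)
    (E : measurableType d) :=
  g_sigma_algebraType (@cylinders I d E).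

HB.instance Definition _ (I : Type) (d : measure_display)
    (E : measurableType d) :=
  Measurable.copy (function_space I E) (g_sigma_algebraType (@cylinders I d E)).

Definition path_law (R : realType) (d d' : measure_display)
    (Omega : measurableType d) (P : probability Omega R)
    (E : measurableType d') (Y : R -> Omega -> E) :
    set (function_space R E) -> \bar R :=
  pushforward P (fun omega => (fun xi => Y xi omega) : function_space R E).

Definition stationary_process (R : realType) (d d' : measure_display)
    (Omega : measurableType d) (P : probability Omega R)
    (E : measurableType d') (Y : R -> Omega -> E) : Prop :=
  (forall xi, measurable_fun setT (Y xi)) /\
  (forall (h : R) (A : set (function_space R E)), measurable A ->
     path_law P (fun xi => Y (xi + h)) A = path_law P Y A).

(* Main.v *)
(* Evaluating the wave-profile identity at the time T xi when the front is at xi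
   gives w (T xi) (x + xi) omega = w 0 x (tau xi omega): the process is an
   observable of the environment carried along the measure-preserving flow. *)

Require Import Defs.
From HB Require Import structures.
From mathcomp Require Import all_boot all_order all_algebra.
From mathcomp Require Import all_classical all_reals all_analysis.
Import Order.TTheory GRing.Theory Num.Theory.
Import numFieldNormedType.Exports.

Local Open Scope classical_set_scope.
Local Open Scope ring_scope.

(** The cylinders generate the sigma-algebra, so only their preimages need checking, and each of
    these is a preimage under a single coordinate. *)
Lemma measurable_fun_function_space (d d' : measure_display)
  (S : measurableType d) (E : measurableType d') (I : Type)
  (f : S -> function_space I E) :
  (forall i, measurable_fun setT (fun s => f s i)) -> measurable_fun setT f.
Proof.
move=> mf; apply: (@measurability _ _ S (function_space I E) setT f
  (@cylinders I d' E)) => //.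
by move=> _ [_ [i [B [mB ->]]] <-]; exact: mf.
Qed.

(** By the group law, translating the path of [omega] by [h] gives the path of [tau h omega]; since
    [tau h] preserves [P], the law of the path does not change. *)
Lemma stationary_process_flow (R : realType) (d d' : measure_display)
  (Omega : measurableType d) (P : probability Omega R)
  (E : measurableType d') (tau : R -> Omega -> Omega) (Y : Omega -> E) :
  measure_preserving_group P tau -> measurable_fun setT Y ->
  stationary_process P (fun xi omega => Y (tau xi omega)).
Proof.
move=> [_ tauD mtau Ptau] mY.
have mYtau xi : measurable_fun setT (fun omega => Y (tau xi omega)).
  exact: measurableT_comp mY (mtau xi).
split=> // h A mA; rewrite /path_law /pushforward.
pose path omega : function_space R E := fun xi => Y (tau xi omega).
have mpath : measurable_fun setT path by exact: measurable_fun_function_space.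
(* Invariance of [P] is read backwards, inserting [tau h] on the unshifted side; it applies only to
   measurable events, whence [mpath]. *)
rewrite -[RHS](Ptau h (path @^-1` A)); last first.
  by rewrite -[_ @^-1` _]setTI; exact: mpath.
(* The iterated preimage is by conversion the preimage of [A] under [path \o tau h], so comparing
   paths pointwise suffices. *)
congr (P (_ @^-1` A)); apply/funext => omega; apply/funext => xi.
by rewrite /path tauD.
Qed.

Theorem corollary1p4 (R : realType)
  (theta0 : R) (htheta0 : 0 < theta0 < 1)
  (f0 : R -> R) (hf0 : ignition theta0 f0)
  (gmin gmax : R) (hgmin : 0 < gmin) (hg : gmin <= gmax)
  (F : set (set (environment hg))) (hF : sigma_algebra setT F)
  (hFopen : <<s @open (environment hg) >> `<=` F)
  (P : probability (g_sigma_algebraType F) R)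
  (tau : R -> g_sigma_algebraType F -> g_sigma_algebraType F)
  (htau : measure_preserving_group P tau)
  (herg : acts_ergodically P tau)
  (g : R -> g_sigma_algebraType F -> R)
  (hgstat : stationary_field tau g)
  (hgreg : {ae P, forall omega,
     [lipschitz g x omega | x in setT] /\
     forall x, gmin <= g x omega <= gmax})
  (cm cp : R) (hc : spreading_speeds P theta0 f0 g cm cp)
  (w : R -> R -> g_sigma_algebraType F -> R)
  (hw : random_traveling_wave P tau g f0 w)
  (X : R -> g_sigma_algebraType F -> R)
  (hX : front_position tau w X)
  (hXtheta0 : forall t omega, w t (X t omega) omega = theta0)
  (hXspeed : {ae P, forall omega, X t omega / t @[t --> +oo] --> cp})
  (hXincr : forall omega, {homo X ^~ omega : s t / s < t})
  (T : R -> g_sigma_algebraType F -> R)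
  (hT : forall x omega, X (T x omega) omega = x) :
  stationary_process P
    (fun xi omega =>
       (fun x => w (T xi omega) (x + xi) omega) : function_space R R).
Proof.
case: hw => _ mw _ _ _; case: hX => _ wE.
(* The identity holds for every [omega], as [wE] and [hT] do, so the process can be replaced
   outright, with no null set to discard. *)
have -> : (fun xi omega =>
    (fun x => w (T xi omega) (x + xi) omega) : function_space R R) =
  (fun xi omega => (fun x => w 0 x (tau xi omega)) : function_space R R).
  apply/funext => xi; apply/funext => omega; apply/funext => x.
  by rewrite wE hT addrK.
(* The observable is the whole profile at time 0, a random element of a function space; its
   measurability reduces to that of each [w 0 x], given by [mw]. *)
apply: (@stationary_process_flow _ _ _ _ P _ tau
  (fun omega => (fun x => w 0 x omega) : function_space R R)) => //.
exact: measurable_fun_function_space.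
Qed.
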